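(* Let $E$ be a finite set and $\mathcal{X}$ a Polish space. For each $x\in\mathcal{X}$ let $(q_t^x)_{t\in\mathbb{Z}}$ and $(\overline{q}_t^x)_{t\in\mathbb{Z}}$ be two sequences of probability kernels from $(E^{\mathbb{N}},\mathcal{P}(E)^{\otimes\mathbb{N}})$ to $(E,\mathcal{P}(E))$. Assume: (A1) for every $t\in\mathbb{Z}$, the maps $(y,z,x)\mapsto q_t^x(y\vert z)$ and $(y,z,x)\mapsto\overline{q}_t^x(y\vert z)$ on $E\times E^{\mathbb{N}}\times\mathcal{X}$ are measurable and take positive values; (A2) setting $b_m:=\sup_{t\in\mathbb{Z}}\sup_{x\in\mathcal{X}}\sup_{y\stackrel{m}{=}\overline{y}}d_{TV}\left(q_t^x(\cdot\vert y),q_t^x(\cdot\vert\overline{y})\right)$ for $m\in\mathbb{N}$, one has $b_0<1$ and $\lim_{m\to\infty}b_m=0$. Fix $t_0\in\mathbb{Z}$. Then for any $x\in\mathcal{X}$ and any $(z,\overline{z})\in E^{\mathbb{N}}\times E^{\mathbb{N}}$ there exists a probability measure $\widetilde{Q}_{t_0,x,z,\overline{z}}$ on $\left(E^{\mathbb{N}^*}\times E^{\mathbb{N}^*},\mathcal{P}(E)^{\otimes\mathbb{N}^*}\otimes\mathcal{P}(E)^{\otimes\mathbb{N}^*}\right)$ such that the following three conditions hold. 1. For all $A,B\in\mathcal{P}(E)^{\otimes\mathbb{N}^*}$, $$\widetilde{Q}_{t_0,x,z,\overline{z}}\left(A\times E^{\mathbb{N}^*}\right)=Q_{t_0,x,z}(A),\qquad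 \widetilde{Q}_{t_0,x,z,\overline{z}}\left(E^{\mathbb{N}^*}\times B\right)=\overline{Q}_{t_0,x,\overline{z}}(B).$$ 2. For every $t\ge 1$, $$\widetilde{Q}_{t_0,x,z,\overline{z}}\left(\left\{(y,\overline{y})\in E^{\mathbb{N}^*}\times E^{\mathbb{N}^*}: y_t\neq\overline{y}_t\right\}\right)\le b_{t-1}^*+\sup_{s\in E^{\mathbb{N}}}d_{TV}\left(q^x_{t+t_0}(\cdot\vert s),\overline{q}^x_{t+t_0}(\cdot\vert s)\right)+\sum_{\ell=0}^{t-2}b_\ell^*\sup_{s\in E^{\mathbb{N}}}d_{TV}\left(q^x_{t+t_0-\ell-1}(\cdot\vert s),\overline{q}^x_{t+t_0-\ell-1}(\cdot\vert s)\right).$$ 3. For every $C\in\mathcal{P}(E)^{\otimes\mathbb{N}^*}\otimes\mathcal{P}(E)^{\otimes\mathbb{N}^*}$, the map $(x,z,\overline{z})\mapsto\widetilde{Q}_{t_0,x,z,\overline{z}}(C)$ is measurable from $\left(\mathcal{X}\times E^{\mathbb{N}}\times E^{\mathbb{N}},\mathcal{B}(\mathcal{X})\otimes\mathcal{P}(E)^{\otimes\mathbb{N}}\otimes\mathcal{P}(E)^{\otimes\mathbb{N}}\right)$ to $([0,1],\mathcal{B}([0,1]))$.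
   Context: $\mathbb{N}=\{0,1,2,\ldots\}$, $\mathbb{N}^*=\mathbb{N}\setminus\{0\}$; $\mathcal{P}(E)$ is the set of all subsets of $E$; $\mathcal{B}(\cdot)$ is the Borel $\sigma$-field. For probability measures $\nu_1,\nu_2$ on a finite set $F$, $d_{TV}(\nu_1,\nu_2)=\frac12\sum_{f\in F}|\nu_1(f)-\nu_2(f)|$. For $y,\overline{y}\in E^{\mathbb{N}}$, $y\stackrel{m}{=}\overline{y}$ means $y_i=\overline{y}_i$ for $0\le i\le m-1$ (no constraint if $m=0$). For a sequence $(y_t)$, write $y_t^-=(y_t,y_{t-1},y_{t-2},\ldots)$. For $z\in E^{\mathbb{N}}$ and $x\in\mathcal{X}$, $Q_{t_0,x,z}$ is the probability distribution on $(E^{\mathbb{N}^*},\mathcal{P}(E)^{\otimes\mathbb{N}^*})$ defined by $$Q_{t_0,x,z}\left(\prod_{i=1}^n\{y_i\}\times\prod_{i=n+1}^\infty E\right)=\prod_{i=1}^n q^x_{t_0+i}\left(y_i\vert y_{i-1}^-\right),$$ with the convention $y_{-j}=z_j$ for $j\ge0$. $\overline{Q}_{t_0,x,z}$ is defined in the same way with the kernels $\overline{q}^x_t$ in place of $q^x_t$. The sequence $(b_n^* )_{n\ge0}$ is defined by $b_0^*=b_0$ and, for $n\ge1$, $b_n^*=\mathbb{P}(S_n^{(b)}=0)$, where $(S_n^{(b)})_{n\ge0}$ is the time-homogeneous Markov chain on $\mathbb{N}$ started at $0$ with transition matrix $P(i,i+1)=1-b_i$, $P(i,0)=b_i$, $i\in\mathbb{N}$.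 An empty sum is $0$. *)

(* Defs.v *)
From HB Require Import structures.
From mathcomp Require Import all_boot all_order all_algebra.
From mathcomp Require Import all_classical all_reals all_analysis.
From mathcomp Require Import measurable_realfun.

Set Implicit Arguments.
Unset Strict Implicit.
Unset Printing Implicit Defensive.

Import Order.TTheory GRing.Theory Num.Theory.
Import numFieldNormedType.Exports.

Local Open Scope classical_set_scope.
Local Open Scope ring_scope.

Definition polish (R : realType) (X : topologicalType) : Prop :=
  (exists D : set X, countable D /\ dense D) /\
  exists dist : X -> X -> R,
    [/\ forall x y, 0 <= dist x y,
        forall x y, dist x y = 0 <-> x = y,
        forall x y, dist x y = dist y x
      & forall x y z, dist x z <= dist x y + dist y z] /\
    (forall A : set X, open A <->
       forall x, A x -> exists2 e, 0 < e & forall y, dist x y < e -> A y) /\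
    (forall u : nat -> X,
       (forall e, 0 < e -> exists N, forall m n, (N <= m)%N -> (N <= n)%N ->
          dist (u m) (u n) < e) ->
       exists l : X, u @ \oo --> l).

Notation borel X := (g_sigma_algebraType (@open X)).

Definition coordinate_sets (d : measure_display) (E : measurableType d) :
    set (set (nat -> E)) :=
  [set B | exists (n : nat) (A : set E),
     measurable A /\ B = [set y | A (y n)]].

(* [nat -> E] with the product sigma-algebra. This one type serves both for
   sequences indexed by 0, 1, 2, ... and for sequences (y_1, y_2, ...) indexed
   by the positive integers; the terms of the latter are read with [term]. *)
Notation seqs E := (g_sigma_algebraType (@coordinate_sets _ E)).

(* y_t, for y = (y_1, y_2, ...) and 1 <= t *)
Definition term (T : Type) (y : nat -> T) (t : nat) : T := y t.-1.

(* y_i^- = (y_i, y_(i-1), ...), where y_(-j) = z_j for 0 <= j *)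
Definition past (T : Type) (y z : nat -> T) (i : nat) : nat -> T :=
  fun j => if (j < i)%N then term y (i - j) else z (j - i)%N.

Definition eq_upto (T : Type) (m : nat) (y y' : nat -> T) : Prop :=
  forall i, (i < m)%N -> y i = y' i.

(* k(y | z) *)
Definition kmass (d : measure_display) (E : measurableType d) (R : realType)
    (k : R.-pker seqs E ~> E) (z : seqs E) (y : E) : R :=
  fine (k z [set y]).

Definition dTV (d : measure_display) (E : measurableType d) (R : realType)
    (nu1 nu2 : set E -> \bar R) : R :=
  2^-1 * \sum_(e \in [set: E]) `|fine (nu1 [set e]) - fine (nu2 [set e])|.

(* b_m *)
Definition memory_coef (d : measure_display) (E : measurableType d)
    (R : realType) (X : Type) (q : int -> X -> R.-pker seqs E ~> E)
    (m : nat) : R :=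
  sup [set r | exists t x y y', eq_upto m y y' /\
                 r = dTV (q t x y) (q t x y')].

Definition sup_dTV (d : measure_display) (E : measurableType d)
    (R : realType) (k k' : R.-pker seqs E ~> E) : R :=
  sup [set dTV (k s) (k' s) | s in [set: seqs E]].

(* mu is the law Q of (y_1, y_2, ...) when the past up to time 0 is z and y_i is
   drawn from k (t0 + i). For a finite E with all subsets measurable, the
   cylinders below form (with the empty set) a pi-system generating the product
   sigma-algebra, so that at most one mu satisfies this. *)
Definition path_law (d : measure_display) (E : measurableType d)
    (R : realType) (k : int -> R.-pker seqs E ~> E) (t0 : int) (z : seqs E)
    (mu : probability (seqs E) R) : Prop :=
  forall (n : nat) (y : nat -> E),
    mu [set u | forall i, (1 <= i <= n)%N -> term u i = term y i] =
    (\prod_(1 <= i < n.+1)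
        kmass (k (t0 + i%:Z)) (past y z i.-1) (term y i))%:E.

Definition markov_chain (d : measure_display) (Omega : measurableType d)
    (R : realType) (P : probability Omega R) (S : nat -> {RV P >-> nat})
    (i0 : nat) (p : nat -> nat -> R) : Prop :=
  P [set w | S 0%N w = i0] = 1%E /\
  forall (n : nat) (s : nat -> nat),
    P [set w | forall i, (i <= n.+1)%N -> S i w = s i] =
    (P [set w | forall i, (i <= n)%N -> S i w = s i] *
     (p (s n) (s n.+1))%:E)%E.

Definition renewal_matrix (R : realType) (b : nat -> R) (i j : nat) : R :=
  if j == 0%N then b i else if j == i.+1 then 1 - b i else 0.

(* b^*_n. The value at n = 0 is b_0, and not P(S_0 = 0) = 1. *)
Definition bstar (d : measure_display) (Omega : measurableType d)
    (R : realType) (P : probability Omega R) (S : nat -> {RV P >-> nat})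
    (b : nat -> R) (n : nat) : R :=
  if n == 0%N then b 0%N else fine (P [set w | S n w = 0%N]).

(* Main.v *)
Require Import Defs.
From HB Require Import structures.
From mathcomp Require Import all_boot all_order all_algebra.
From mathcomp Require Import all_classical all_reals all_analysis.
From mathcomp Require Import measurable_realfun.
From mathcomp Require Import lra zify.

Set Implicit Arguments.
Unset Strict Implicit.
Unset Printing Implicit Defensive.

Import Order.TTheory GRing.Theory Num.Theory.
Import numFieldNormedType.Exports.

Local Open Scope classical_set_scope.
Local Open Scope ring_scope.

(** The two processes are run together. At each time the next pair of letters is
    drawn from a maximal coupling of the two conditional laws given the two
    pasts, so that the letters differ with probability at most the total
    variation distance of these laws ([coupling_neq]). If the last [i] pairs
    have agreed, this distance is at most [b_i] plus the distance [delta_t]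
    between the kernels [q] and [qbar] at that time ([coupled_step_differ]).
    The renewal chain [S] falls from [i] to [0] with probability [b_i]; hence the
    number of most recent agreements falls to [0] at time [t] with a probability
    that exceeds the one for [S] by at most [delta_t].

    Let [f_n i] be the probability that [S], started at [i], is at [0] after [n]
    steps ([zero_prob]). As [b] is nonincreasing, [f_n] is nonincreasing in [i]
    and [f_n 0] is nonincreasing in [n]. A backward recursion over the remaining
    time then charges each fall caused by [delta_s] at most [delta_s f_(t-s) 0]
    ([word_mean_zero_prob]):
      P (y_t <> ybar_t) <= f_t 0 + sum over s in 1..t of delta_s f_(t-s) 0,
    and [f_(n+1) 0 <= b*_n] for every [n] gives the bound.

    To obtain a measure on infinite paths, depending measurably on the initial
    data, all randomness is read from one uniform variable on the unit interval.
    The interval is cut into pieces whose lengths are the probabilities of the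
    first pair, each piece is cut again for the second pair, and so on; the path
    coded by [u] is the one whose pieces all contain [u] ([code],
    [noise_code]). The path is jointly measurable in [u] and the initial data,
    and the coupling is its law under the uniform distribution
    ([exists_law_of_noise]). The marginals are identified by their values on
    cylinders ([path_law_unique]). *)

(** * Laws of random words given letter by letter *)

(** Words list the most recent letter first, so that a word is also the visible
    part of the past of the next letter. *)

Section WordLaw.
Context (R : realType) (F : choiceType) (e : seq F).
Implicit Types (k : seq F -> F -> R) (g h : seq F -> R) (w : seq F).

Definition stochastic k :=
  (forall w a, 0 <= k w a) /\ (forall w, \sum_(a <- e) k w a = 1).

Fixpoint word_mass k w : R :=
  if w is a :: w' then word_mass k w' * k w' a else 1.

(** The mean of [g] over words of length [n], integrating out the most recent
    letter first: one-step estimates can be iterated in this form. *)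
Fixpoint word_mean k n g : R :=
  if n is n'.+1
  then word_mean k n' (fun w => \sum_(a <- e) k w a * g (a :: w))
  else g [::].

Fixpoint words n : seq (seq F) :=
  if n is n'.+1 then [seq a :: w | w <- words n', a <- e] else [:: [::]].

Lemma mem_words n w : (forall a, a \in e) -> (w \in words n) = (size w == n).
Proof.
move=> fulle; elim: n w => [|n IH] w /=; first by rewrite inE; case: w.
apply/allpairsP/eqP => [[[w' a]] /= [+ _ ->] /=|].
  by rewrite IH => /eqP ->.
case: w => // a w [sw]; exists (w, a); split=> //=.
by rewrite IH sw.
Qed.

Lemma words_uniq n : uniq e -> uniq (words n).
Proof.
move=> ue; elim: n => //= n IH; apply: allpairs_uniq => //.
by move=> [w a] [w' a'] _ _ /= [-> ->].
Qed.

Lemma word_meanE k n g :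
  word_mean k n g = \sum_(w <- words n) word_mass k w * g w.
Proof.
elim: n g => [|n IH] g /=; first by rewrite big_seq1 mul1r.
rewrite big_allpairs_dep IH; apply: eq_bigr => w _ /=.
by rewrite mulr_sumr; apply: eq_bigr => a _; rewrite mulrA.
Qed.

Lemma eq_word_mean k n g h : (forall w, size w = n -> g w = h w) ->
  word_mean k n g = word_mean k n h.
Proof.
elim: n g h => [|n IH] g h gh /=; first exact: gh.
by apply: IH => w sw; apply: eq_bigr => a _; rewrite gh//= sw.
Qed.

Lemma le_word_mean k n g h : stochastic k ->
  (forall w, size w = n -> g w <= h w) -> word_mean k n g <= word_mean k n h.
Proof.
move=> [k0 _]; elim: n g h => [|n IH] g h gh /=; first exact: gh.
apply: IH => w sw; apply: ler_sum => a _; apply: ler_wpM2l => //.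
by apply: gh; rewrite /= sw.
Qed.

Lemma word_mean_cstD k n g (c : R) : stochastic k ->
  word_mean k n (fun w => g w + c) = word_mean k n g + c.
Proof.
move=> [_ k1]; elim: n g => //= n IH g; rewrite -IH.
apply: eq_word_mean => w _; under eq_bigr do rewrite mulrDr.
by rewrite big_split /= -mulr_suml k1 mul1r.
Qed.

Lemma word_mean_scale k n g (c : R) :
  word_mean k n (fun w => c * g w) = c * word_mean k n g.
Proof.
elim: n g => //= n IH g; rewrite -IH; apply: eq_word_mean => w _.
by rewrite mulr_sumr; apply: eq_bigr => a _; rewrite mulrCA.
Qed.

End WordLaw.

(** If, whatever the past, the image under [f] of the next letter has a law
    depending only on the image of the past, then the images form a chain of
    their own. Used with both projections of a coupling. *)
Lemma word_mean_image (R : realType) (F G : choiceType) (e : seq F)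
    (f : F -> G) (k : seq F -> F -> R) (q : seq G -> G -> R) (v : seq G) :
  (forall w b, \sum_(a <- e | f a == b) k w a = q (map f w) b) ->
  word_mean e k (size v) (fun w => (map f w == v)%:R) = word_mass q v.
Proof.
move=> kq; elim: v => [|b v IH] //=; rewrite -{}IH mulrC -word_mean_scale.
apply: eq_word_mean => w _.
case: (eqVneq (map f w) v) => [<-|wv]; last first.
  rewrite mulr0 big1// => a _.
  by rewrite eqseq_cons (negbTE wv) andbF mulr0.
rewrite mulr1 -kq [RHS]big_mkcond /=; apply: eq_bigr => a _.
by rewrite eqseq_cons eqxx andbT; case: eqP; rewrite ?mulr1 ?mulr0.
Qed.

(** * Coding words by nested intervals *)

Section IntervalCoding.
Context (R : realType) (F : choiceType) (e : seq F) (a0 : F).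
Hypotheses (ue : uniq e) (fulle : forall a, a \in e).
Context (k : seq F -> F -> R).
Hypothesis sk : stochastic e k.

Let m := word_mass k.

(** The interval of a word is divided among its one-letter extensions, in the
    order of [e] and proportionally to their conditional probabilities. *)
Fixpoint left_end w : R :=
  if w is a :: w' then
    left_end w' + word_mass k w' * \sum_(b <- take (index a e) e) k w' b
  else 0.

Definition word_itv w : set R :=
  [set u | left_end w <= u < left_end w + word_mass k w].

Definition next_letter (u : R) w : F := xget a0 [set a | word_itv (a :: w) u].

Fixpoint code (u : R) n : seq F :=
  if n is n'.+1 then next_letter u (code u n') :: code u n' else [::].

Lemma word_mass_ge0 w : 0 <= m w.
Proof.
rewrite /m; case: sk => k0 _; elim: w => [|a w IH] /=; first exact: ler01.
exact: mulr_ge0.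
Qed.

(** The dividing points of the interval of [w]: their monotonicity in the index
    gives both disjointness and nesting of the pieces. *)
Let cut w i := left_end w + m w * \sum_(b <- take i e) k w b.

Let cut_le w i j : (i <= j)%N -> cut w i <= cut w j.
Proof.
move=> ij; rewrite lerD2l; apply: ler_wpM2l; first exact: word_mass_ge0.
rewrite -(subnKC ij) takeD big_cat /= lerDl sumr_ge0// => b _.
exact: sk.1.
Qed.

Let right_end_cut w a :
  left_end (a :: w) + m (a :: w) = cut w (index a e).+1.
Proof.
have ia : (index a e < size e)%N by rewrite index_mem.
rewrite /cut /m /= (take_nth a0 ia) nth_index// -cats1 big_cat /=.
by rewrite big_seq1 mulrDr addrA.
Qed.

Let word_itv_cut w a :
  word_itv (a :: w) = [set u | cut w (index a e) <= u < cut w (index a e).+1].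
Proof. by rewrite /word_itv -right_end_cut. Qed.

Lemma left_end_cons_ge w a : left_end w <= left_end (a :: w).
Proof.
rewrite /= lerDl mulr_ge0 ?word_mass_ge0// sumr_ge0// => b _.
exact: sk.1.
Qed.

Lemma right_end_cons_le w a :
  left_end (a :: w) + m (a :: w) <= left_end w + m w.
Proof.
rewrite right_end_cut; have -> : left_end w + m w = cut w (size e).
  by rewrite /cut take_size sk.2 mulr1.
by apply: cut_le; rewrite index_mem.
Qed.

Lemma left_end_ge0 w : 0 <= left_end w.
Proof. by elim: w => // a w IH; apply: le_trans IH (left_end_cons_ge w a). Qed.

Lemma right_end_le1 w : left_end w + m w <= 1.
Proof.
elim: w => [|a w IH]; first by rewrite /= add0r.
exact: le_trans (right_end_cons_le w a) IH.
Qed.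

Lemma word_itv_cons_sub w a : word_itv (a :: w) `<=` word_itv w.
Proof.
move=> u /andP[lu ru]; apply/andP; split.
  exact: le_trans (left_end_cons_ge w a) lu.
exact: lt_le_trans ru (right_end_cons_le w a).
Qed.

Lemma word_itv_unit w : word_itv w `<=` [set u | 0 <= u < 1].
Proof.
move=> u /andP[lu ru]; apply/andP; split.
  exact: le_trans (left_end_ge0 w) lu.
exact: lt_le_trans ru (right_end_le1 w).
Qed.

Lemma word_itv_cons_inj w a b u :
  word_itv (a :: w) u -> word_itv (b :: w) u -> a = b.
Proof.
rewrite !word_itv_cut /= => /andP[la ra] /andP[lb rb].
have {}la := le_lt_trans la rb; have {}lb := le_lt_trans lb ra.
have lei i j : cut w i < cut w j.+1 -> (i <= j)%N.
  by apply: contraTT; rewrite -ltnNge -leNgt; exact: cut_le.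
have : index a e = index b e by apply/eqP; rewrite eqn_leq !lei.
exact: index_inj.
Qed.

Lemma word_itv_cons_ex w u : word_itv w u -> exists a, word_itv (a :: w) u.
Proof.
move=> /= /andP[lu ru].
have ex_i : exists i, u < cut w i.
  by exists (size e); rewrite /cut take_size sk.2 mulr1.
case: (ex_minnP ex_i) => -[|i] iu imin.
  by move: iu; rewrite /cut take0 big_nil mulr0 addr0 ltNge lu.
have ie : (i < size e)%N.
  by apply: imin; rewrite /cut take_size sk.2 mulr1.
exists (nth a0 e i); rewrite word_itv_cut /= index_uniq// iu andbT leNgt.
by apply/negP => /imin; rewrite ltnn.
Qed.

Lemma size_code u n : size (code u n) = n.
Proof. by elim: n => //= n ->. Qed.

Lemma code_itv u w : 0 <= u < 1 -> code u (size w) = w <-> word_itv w u.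
Proof.
move=> u01; elim: w => [|a w IH] /=.
  by split=> // _; move: u01 => /=; rewrite /word_itv /= add0r.
split=> [[<- cw]|aw].
  rewrite cw /next_letter; case: xgetP => // none.
  by have [b] := word_itv_cons_ex (IH.1 cw); move=> /none.
have -> : code u (size w) = w by apply/IH; exact: word_itv_cons_sub aw.
congr (_ :: _); rewrite /next_letter; case: xgetP => [b _ bw|/(_ a)//].
exact: word_itv_cons_inj bw aw.
Qed.

(** Outside the unit interval no letter qualifies and the default [a0] is
    produced for ever; this keeps [code] measurable on the whole line. *)
Lemma code_out u n : ~ (0 <= u < 1) -> code u n = nseq n a0.
Proof.
move=> u01; elim: n => //= n ->; congr (_ :: _).
by rewrite /next_letter; case: xgetP => // a _ /word_itv_unit.
Qed.

Lemma code_fiber w : [set u | code u (size w) = w] =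
  word_itv w `|`
  (if w == nseq (size w) a0 then ~` [set u | 0 <= u < 1] else set0).
Proof.
apply/seteqP; split=> u /=.
  have [u01|u01] := pselect (0 <= u < 1).
    by move=> /(code_itv w u01); left.
  by move=> cw; right; rewrite -{1}cw (code_out _ u01) eqxx.
move=> [uw|]; first by apply/code_itv => //; exact: word_itv_unit uw.
by case: eqP => // {2}-> u01; rewrite code_out.
Qed.

End IntervalCoding.

(** * The law of the coded word under uniform noise *)

Section UniformNoise.
Context (R : realType).

Definition noise : probability (measurableTypeR R) R := uniform_prob (@ltr01 R).

Lemma noise_itv (a m : R) : 0 <= a -> 0 <= m -> a + m <= 1 ->
  noise [set u | a <= u < a + m] = m%:E.
Proof.
move=> a0 m0 am1; rewrite /noise /= /uniform_prob.
have -> : [set u | a <= u < a + m] = `[a, a + m[%classic.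
  by apply/seteqP; split=> u /=; rewrite in_itv.
rewrite integral_uniform_pdf setIidl; last first.
  move=> u /=; rewrite !in_itv /= => /andP[au um]; rewrite (le_trans a0 au) /=.
  exact: le_trans (ltW um) am1.
under eq_integral.
  move=> u; rewrite inE /= in_itv /= => /andP[au um].
  rewrite /uniform_pdf (le_trans a0 au) (le_trans (ltW um) am1) subr0 invr1.
  over.
rewrite integral_cst//= lebesgue_measure_itv /= lte_fin mul1e.
case: ltP => [_|]; first by rewrite -EFinD addrC addKr.
rewrite gerDl => m_le0; congr (_%:E); apply/eqP.
by rewrite eq_le m0 m_le0.
Qed.

Lemma noise_out : noise (~` [set u | 0 <= u < 1]) = 0%E.
Proof.
have unitE : `[0, 1[%classic = [set u : R | 0 <= u < 1].
  by apply/seteqP; split=> u /=; rewrite in_itv.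
have := @noise_itv 0 1 (lexx 0) ler01; rewrite add0r => /(_ (lexx 1)) unit1.
by rewrite -unitE probability_setC// unitE unit1 subee.
Qed.

End UniformNoise.

Section NoiseRepresentation.
Context (d : measure_display) (Theta : measurableType d) (R : realType).
Context (F : choiceType) (e : seq F) (a0 : F).
Hypotheses (ue : uniq e) (fulle : forall a, a \in e).
Context (k : Theta -> seq F -> F -> R).
Hypothesis sk : forall theta, stochastic e (k theta).
Hypothesis mk : forall w a, measurable_fun setT (fun theta => k theta w a).

Lemma measurable_word_mass w :
  measurable_fun setT (fun theta => word_mass (k theta) w).
Proof. by elim: w => //= a w IH; exact: measurable_funM. Qed.

Lemma measurable_left_end w :
  measurable_fun setT (fun theta => left_end e (k theta) w).
Proof.
elim: w => //= a w IH; apply: measurable_funD => //.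
by apply: measurable_funM; [exact: measurable_word_mass|exact: measurable_sum].
Qed.

Lemma measurable_code_fiber w :
  measurable [set p : Theta * measurableTypeR R |
    code e a0 (k p.1) p.2 (size w) = w].
Proof.
have mu : measurable_fun setT (fun p : Theta * measurableTypeR R => p.2 : R).
  exact: measurable_snd.
have mlt (f g : Theta * measurableTypeR R -> R) : measurable_fun setT f ->
    measurable_fun setT g -> measurable [set p | f p < g p].
  move=> mf mg; rewrite -[X in measurable X]setTI.
  exact: (measurable_fun_ltr mf mg measurableT (Y := [set true]) I).
have mle (f g : Theta * measurableTypeR R -> R) : measurable_fun setT f ->
    measurable_fun setT g -> measurable [set p | f p <= g p].
  move=> mf mg; rewrite -[X in measurable X]setTI.
  exact: (measurable_fun_ler mf mg measurableT (Y := [set true]) I).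
have -> : [set p : Theta * measurableTypeR R |
    code e a0 (k p.1) p.2 (size w) = w] =
  ([set p | left_end e (k p.1) w <= p.2] `&`
   [set p | p.2 < left_end e (k p.1) w + word_mass (k p.1) w]) `|`
  (if w == nseq (size w) a0
   then ~` ([set p | 0 <= p.2] `&` [set p | p.2 < 1]) else set0).
  apply/seteqP; split=> -[theta u] /=.
    have := code_fiber a0 ue fulle (sk theta) w.
    move=> /seteqP[/(_ u) + _] => /[apply] -[/andP[lu ru]|]; first by left.
    by case: ifP => // _ uout; right => -[u0 u1]; apply: uout; apply/andP.
  have := code_fiber a0 ue fulle (sk theta) w.
  move=> /seteqP[_ /(_ u) /= fib] uw; apply: fib; case: uw => [[lu ru]|].
    by left; apply/andP.
  by case: ifP => // _ uout; right => /andP[u0 u1]; exact: uout.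
have mL : measurable_fun setT (fun p : Theta * measurableTypeR R =>
    left_end e (k p.1) w).
  exact: (measurableT_comp (measurable_left_end w)).
have mW : measurable_fun setT (fun p : Theta * measurableTypeR R =>
    word_mass (k p.1) w).
  exact: (measurableT_comp (measurable_word_mass w)).
apply: measurableU.
  by apply: measurableI; [exact: mle|apply: mlt => //; exact: measurable_funD].
case: ifP => // _; apply: measurableC; apply: measurableI.
  exact: mle.
exact: mlt.
Qed.

(** Events about the coded word are finite unions of fibers: measurability and
    probability are both computed fiber by fiber. *)
Lemma code_cover (theta : Theta) u n (G : set (seq F)) :
  G (code e a0 (k theta) u n) <->
  (exists2 w, w \in words e n /\ G w & code e a0 (k theta) u (size w) = w).
Proof.
split=> [Gu|[w [+ Gw] cw]].
  exists (code e a0 (k theta) u n); last by rewrite size_code.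
  by split=> //; rewrite mem_words// size_code.
by rewrite mem_words// => /eqP <-; rewrite cw.
Qed.

Lemma measurable_code n (G : set (seq F)) :
  measurable [set p : Theta * measurableTypeR R | G (code e a0 (k p.1) p.2 n)].
Proof.
have -> : [set p : Theta * measurableTypeR R | G (code e a0 (k p.1) p.2 n)] =
  \bigcup_(w in [set w | w \in words e n /\ G w])
     [set p : Theta * measurableTypeR R | code e a0 (k p.1) p.2 (size w) = w].
  apply/seteqP; split=> -[theta u] /=; first by move/code_cover.
  by move=> ?; exact/code_cover.
apply: fin_bigcup_measurable => [|w _]; last exact: measurable_code_fiber.
apply: (@sub_finite_set _ _ [set` words e n]) => [w []//|].
exact: finite_seq.
Qed.

Lemma measurable_code_section theta n (G : set (seq F)) :
  measurable [set u : measurableTypeR R | G (code e a0 (k theta) u n)].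
Proof.
rewrite [X in measurable X](_ : _ = xsection
  [set p : Theta * measurableTypeR R | G (code e a0 (k p.1) p.2 n)] theta).
  apply: measurable_xsection; exact: measurable_code.
by apply/seteqP; split=> u /=; rewrite /xsection /= inE.
Qed.

Lemma noise_code_fiber theta w :
  noise R [set u | code e a0 (k theta) u (size w) = w] =
  (word_mass (k theta) w)%:E.
Proof.
rewrite code_fiber// measureU0 //=.
- apply: noise_itv.
  + exact: (left_end_ge0 (sk theta)).
  + exact: (word_mass_ge0 (sk theta)).
  + by apply: right_end_le1.
- rewrite /word_itv (_ : [set u | _] =
    `[left_end e (k theta) w,
      left_end e (k theta) w + word_mass (k theta) w[%classic).
    exact: measurable_itv.
  by apply/seteqP; split=> u /=; rewrite in_itv.
- case: ifP => // _; apply: measurableC.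
  rewrite (_ : [set u | _] = `[0, 1[%classic); first exact: measurable_itv.
  by apply/seteqP; split=> u /=; rewrite in_itv.
- by case: ifP => // _; exact: noise_out.
Qed.

Lemma noise_code theta n (G : set (seq F)) :
  noise R [set u | G (code e a0 (k theta) u n)] =
  (word_mean e (k theta) n (fun w => (`[< G w >])%:R))%:E.
Proof.
have -> : [set u | G (code e a0 (k theta) u n)] =
  \bigcup_(w in [set w | w \in words e n /\ G w])
     [set u | code e a0 (k theta) u (size w) = w].
  by apply/seteqP; split=> u /=; [move/code_cover|move=> ?; exact/code_cover].
have finG : finite_set [set w | w \in words e n /\ G w].
  apply: (@sub_finite_set _ _ [set` words e n]) => [w []//|].
  exact: finite_seq.
rewrite measure_fin_bigcup//; last 2 first.
- move=> v w [+ _] [+ _]; rewrite !mem_words// => /eqP sv /eqP sw.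
  move=> [u [/= uv uw]].
  by rewrite -uv -uw sv sw.
- by move=> w _; exact: (@measurable_code_section theta (size w) [set w]).
rewrite word_meanE.
rewrite (eq_fsbigr (fun w => (word_mass (k theta) w)%:E)); last first.
  by move=> w _; exact: noise_code_fiber.
rewrite fsumEFin//; congr (_%:E).
rewrite (_ : [set w | _ /\ _] = [set` [seq w <- words e n | `[< G w >]]]).
  rewrite -fsbig_seq ?filter_uniq ?words_uniq// big_filter big_mkcond /=.
  by apply: eq_bigr => w _; case: asboolP; rewrite ?mulr1 ?mulr0.
apply/seteqP; split=> w /=; rewrite mem_filter.
  by move=> [-> Gw]; rewrite andbT; exact/asboolP.
by move=> /andP[/asboolP].
Qed.

End NoiseRepresentation.

(** * Maximal coupling of two laws on a finite set *)

Section MaximalCoupling.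
Context (R : realType) (T : choiceType) (e : seq T).
Hypotheses (ue : uniq e) (fulle : forall a, a \in e).
Implicit Types p q r : T -> R.

Definition tv p q : R := 2^-1 * \sum_(a <- e) `|p a - q a|.

Definition excess p q a : R := p a - Order.min (p a) (q a).

(** The common part of [p] and [q] is put on the diagonal, and the two excesses
    are made independent. If the excesses vanish, the division by [0] yields
    [0], which is the right value. *)
Definition coupling p q (ab : T * T) : R :=
  (ab.1 == ab.2)%:R * Order.min (p ab.1) (q ab.1) +
  excess p q ab.1 * excess q p ab.2 / \sum_(a <- e) excess p q a.

Definition mass_fun p := (forall a, 0 <= p a) /\ \sum_(a <- e) p a = 1.

Lemma tv_ge0 p q : 0 <= tv p q.
Proof. by rewrite mulr_ge0 ?invr_ge0// sumr_ge0. Qed.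

Lemma tv_triangle p q r : tv p r <= tv p q + tv q r.
Proof.
rewrite -mulrDr ler_wpM2l ?invr_ge0// -big_split /=.
by apply: ler_sum => a _; exact: ler_distD.
Qed.

Lemma tv_le1 p q : mass_fun p -> mass_fun q -> tv p q <= 1.
Proof.
move=> [p0 p1] [q0 q1]; rewrite ler_pdivrMl// mulr1.
apply: (@le_trans _ _ (\sum_(a <- e) (p a + q a))); last first.
  by rewrite big_split /= p1 q1.
apply: ler_sum => a _; rewrite (le_trans (ler_normB _ _))//.
by rewrite !ger0_norm.
Qed.

Lemma excess_ge0 p q a : 0 <= excess p q a.
Proof. by rewrite subr_ge0 ge_min lexx. Qed.

Lemma excess_sumC p q : mass_fun p -> mass_fun q ->
  \sum_(a <- e) excess q p a = \sum_(a <- e) excess p q a.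
Proof.
move=> [_ p1] [_ q1]; rewrite !sumrB p1 q1; congr (_ - _).
by apply: eq_bigr => a _; rewrite minC.
Qed.

Lemma excess_sum p q : mass_fun p -> mass_fun q ->
  \sum_(a <- e) excess p q a = tv p q.
Proof.
move=> mp mq; rewrite /tv.
have -> : \sum_(a <- e) `|p a - q a| =
    \sum_(a <- e) excess p q a + \sum_(a <- e) excess q p a.
  rewrite -big_split; apply: eq_bigr => a _ /=.
  by rewrite /excess; case: lerP => pq; lra.
rewrite (excess_sumC mp mq); lra.
Qed.

Lemma coupling_ge0 p q ab : mass_fun p -> mass_fun q -> 0 <= coupling p q ab.
Proof.
move=> [p0 _] [q0 _]; rewrite addr_ge0//.
  by rewrite mulr_ge0// le_min p0 q0.
rewrite divr_ge0 ?mulr_ge0 ?excess_ge0// sumr_ge0// => a _.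
exact: excess_ge0.
Qed.

Lemma couplingC p q a b : mass_fun p -> mass_fun q ->
  coupling p q (a, b) = coupling q p (b, a).
Proof.
move=> mp mq; rewrite /coupling /= (excess_sumC mp mq) eq_sym.
by rewrite (mulrC (excess q p b)); case: eqP => [->|]; rewrite ?mul0r// minC.
Qed.

Lemma coupling_fst p q a : mass_fun p -> mass_fun q ->
  \sum_(b <- e) coupling p q (a, b) = p a.
Proof.
move=> mp mq; rewrite big_split /=.
have -> : \sum_(b <- e) (a == b)%:R * Order.min (p a) (q a) =
          Order.min (p a) (q a).
  rewrite (bigD1_seq a) //= eqxx mul1r big1 ?addr0// => b ba.
  by rewrite eq_sym (negbTE ba) mul0r.
rewrite -mulr_suml -mulr_sumr (excess_sumC mp mq).
set D := \sum_(a <- e) excess p q a.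
have [D0|D0] := eqVneq D 0; last by rewrite mulfK// /excess addrC subrK.
have ea0 : excess p q a = 0.
  move/eqP: D0; rewrite psumr_eq0; last by move=> b _; exact: excess_ge0.
  by move=> /allP /(_ a (fulle a)) /eqP.
by rewrite ea0 mul0r mul0r addr0; apply/esym/subr0_eq.
Qed.

Lemma coupling_snd p q b : mass_fun p -> mass_fun q ->
  \sum_(a <- e) coupling p q (a, b) = q b.
Proof.
move=> mp mq; rewrite -(coupling_fst b mq mp).
by apply: eq_bigr => a _; rewrite couplingC.
Qed.

Lemma coupling_neq p q : mass_fun p -> mass_fun q ->
  \sum_(a <- e) \sum_(b <- e | a != b) coupling p q (a, b) <= tv p q.
Proof.
move=> mp mq; rewrite -excess_sum//; set D := \sum_(a <- e) excess p q a.
have D0 : 0 <= D by rewrite sumr_ge0// => a _; exact: excess_ge0.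
apply: (@le_trans _ _ (\sum_(a <- e) \sum_(b <- e)
    excess p q a * excess q p b / D)); last first.
  under eq_bigr do rewrite -mulr_suml -mulr_sumr (excess_sumC mp mq) -mulrA.
  rewrite -mulr_suml -/D.
  by have [->|Dn0] := eqVneq D 0; rewrite ?mul0r// mulfV// mulr1.
apply: ler_sum => a _; rewrite big_mkcond /=; apply: ler_sum => b _.
rewrite /coupling /= -/D; case: eqP => /= _; last by rewrite mul0r add0r.
by rewrite !mulr_ge0 ?invr_ge0 ?excess_ge0.
Qed.

End MaximalCoupling.

(** * The renewal chain *)

Section RenewalChain.
Context (R : realType) (b : nat -> R).

(** The probability of being at [0] after [n] steps of the chain from [i],
    by conditioning on the first step. *)
Fixpoint zero_prob (n i : nat) : R :=
  if n is n'.+1 then b i * zero_prob n' 0%N + (1 - b i) * zero_prob n' i.+1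
  else (i == 0%N)%:R.

(** By induction on [n]: compared with the chain started from [i.+1], the chain
    started from [i] jumps to [0], the best start for the remaining steps, with
    a larger probability, and it stays one step below when both move up. *)
Lemma zero_prob_decr (b0 : forall i, 0 <= b i) (b1 : forall i, b i <= 1)
    (bdecr : forall i, b i.+1 <= b i) n i :
  0 <= zero_prob n i.+1 <= zero_prob n i.
Proof.
elim: n i => [|n IH] i /=; first by rewrite lexx ler0n.
have /andP[h2 h21] := IH i.+1; have /andP[h1 h10] := IH i.
have h0 : zero_prob n i.+1 <= zero_prob n 0.
  by elim: {h1 h10 h2 h21} i => [|i IHi]; [have /andP[] := IH 0%N|
    have /andP[_ /le_trans] := IH i.+1; exact].
have := b0 i; have := b1 i; have := bdecr i; have := b0 i.+1; have := b1 i.+1.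
by move=> *; apply/andP; split; nra.
Qed.

Lemma zero_prob_le0 (b0 : forall i, 0 <= b i) (b1 : forall i, b i <= 1)
    (bdecr : forall i, b i.+1 <= b i) n i : 0 <= zero_prob n i <= zero_prob n 0.
Proof.
elim: i => [|i /andP[_ IH]].
  have /andP[h1 h10] := zero_prob_decr b0 b1 bdecr n 0.
  by rewrite lexx (le_trans h1).
have /andP[h1 h10] := zero_prob_decr b0 b1 bdecr n i.
by rewrite h1 (le_trans h10).
Qed.

(** The first step can only move the chain up from its starting point [0]. *)
Lemma zero_prob_start_decr (b0 : forall i, 0 <= b i) (b1 : forall i, b i <= 1)
    (bdecr : forall i, b i.+1 <= b i) n : zero_prob n.+1 0 <= zero_prob n 0.
Proof.
have /andP[h1 h10] := zero_prob_decr b0 b1 bdecr n 0.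
by rewrite /=; have := b0 0%N; have := b1 0%N; nra.
Qed.

(** A renewal chain almost surely jumps to [0] or one step up, so that the event
    of a prefix splits into two longer prefixes up to a null set. Induction on
    the remaining time [m], for all prefixes, then gives the probability of
    being at [0] conditionally on a prefix. *)
Lemma markov_chain_zero_prob (b0 : forall i, 0 <= b i) (b1 : forall i, b i <= 1)
    (dO : measure_display) (Omega : measurableType dO)
    (P : probability Omega R) (S : nat -> {RV P >-> nat}) :
  markov_chain S 0 (renewal_matrix b) ->
  forall n, P [set w | S n w = 0%N] = (zero_prob n 0)%:E.
Proof.
move=> [S0 markov].
have mS n (A : set nat) : measurable [set w | A (S n w)].
  exact: (@measurable_funPTI _ _ _ _ (S n) A).
pose path n (s : nat -> nat) := [set w | forall i, (i <= n)%N -> S i w = s i].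
have mpath n s : measurable (path n s).
  rewrite (_ : path n s =
    \bigcap_(i in [set i | (i <= n)%N]) [set w | S i w = s i]).
    by apply: bigcap_measurable => [|i _]; [exists 0%N|exact: (mS i [set s i])].
  by apply/seteqP; split=> w.
have hit n m s : P (path n s `&` [set w | S (n + m)%N w = 0%N]) =
    (P (path n s) * (zero_prob m (s n))%:E)%E.
  elim: m n s => [|m IH] n s.
    rewrite addn0 /=; case: eqP => [sn0|sn0].
      rewrite mule1 setIidl// => w /(_ n (leqnn n)) /= ->; exact: sn0.
    rewrite mule0 (_ : _ `&` _ = set0) ?measure0//.
    by apply/seteqP; split=> w //= [/(_ n (leqnn n)) -> ].
  pose upd j := fun i => if (i <= n)%N then s i else j.
  have pathS j : path n.+1 (upd j) = path n s `&` [set w | S n.+1 w = j].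
    apply/seteqP; split=> w /=.
      move=> pw; split=> [i ni|].
        by rewrite pw ?leqW// /upd ni.
      by rewrite pw// /upd ltnn.
    move=> [pw <-] i; rewrite leq_eqVlt => /orP[/eqP ->|].
      by rewrite /upd ltnn.
    by rewrite ltnS => ni; rewrite /upd ni pw.
  have Ppath j : P (path n.+1 (upd j)) =
      (P (path n s) * (renewal_matrix b (s n) j)%:E)%E.
    rewrite [LHS]markov /upd leqnn ltnn; congr (P _ * _)%E.
    by apply/seteqP; split=> w /= + i ni => /(_ i ni); rewrite ni.
  have IHj j : P (path n.+1 (upd j) `&` [set w | S (n + m.+1)%N w = 0%N]) =
      (P (path n.+1 (upd j)) * (zero_prob m j)%:E)%E.
    by rewrite addnS -addSn IH /upd ltnn.
  have fin A : measurable A -> P A \is a fin_num.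
    by move=> mA; exact: fin_num_measure.
  set A := path n s; set Z := [set w | _].
  pose B0 := path n.+1 (upd 0%N); pose B1 := path n.+1 (upd (s n).+1).
  have mZ : measurable Z by exact: (mS _ [set 0%N]).
  have [mA mB0 mB1] : [/\ measurable A, measurable B0 & measurable B1].
    by split; exact: mpath.
  have B01 : B0 `&` B1 = set0.
    apply/seteqP; split=> // w [/(_ n.+1 (leqnn _)) S0w /(_ n.+1 (leqnn _))].
    by rewrite S0w /upd ltnn.
  have PB : P (B0 `|` B1) = P A.
    rewrite measureU// [X in (X + _)%E]Ppath [X in (_ + X)%E]Ppath.
    rewrite /renewal_matrix /= eqxx -ge0_muleDr ?lee_fin ?subr_ge0//.
    by rewrite -EFinD addrC subrK mule1.
  have AB : A `&` (B0 `|` B1) = B0 `|` B1.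
    by apply/setIidPr; rewrite /B0 /B1 !pathS => w [] [].
  (* The two admissible jumps exhaust the mass of the prefix. *)
  have PN : P (A `\` (B0 `|` B1)) = 0%E.
    rewrite measureD//; last 2 first.
    + exact: measurableU.
    + by rewrite ltey_eq fin.
    by rewrite AB [X in (_ - X)%E]PB subee ?fin.
  have -> : A `&` Z = (B0 `&` Z `|` B1 `&` Z) `|` ((A `\` (B0 `|` B1)) `&` Z).
    by rewrite -!setIUl setDUK// -AB; exact: subIsetl.
  have mN : measurable (A `\` (B0 `|` B1)).
    by apply: measurableD => //; exact: measurableU.
  rewrite measureU0; last 3 first.
  + by apply: measurableU; exact: measurableI.
  + exact: measurableI.
  + by apply: (subset_measure0 _ mN _ PN); [exact: measurableI|exact: subIsetl].
  rewrite measureU; last 3 first.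
  + exact: measurableI.
  + exact: measurableI.
  + by rewrite setIACA B01 set0I.
  rewrite [X in (X + _)%E]IHj [X in (_ + X)%E]IHj !Ppath.
  rewrite /renewal_matrix /= eqxx -!muleA -!EFinM -muleDr ?fin//.
move=> n; have := hit 0%N n (fun=> 0%N); rewrite add0n.
have -> : path 0%N (fun=> 0%N) = [set w | S 0%N w = 0%N].
  apply/seteqP; split=> w /=; first by apply.
  by move=> ? i; rewrite leqn0 => /eqP ->.
rewrite S0 mul1e => <-.
have mS0 : measurable [set w | S 0%N w = 0%N] by exact: (mS _ [set 0%N]).
have mSn : measurable [set w | S n w = 0%N] by exact: (mS _ [set 0%N]).
have PC : P (~` [set w | S 0%N w = 0%N]) = 0%E.
  by rewrite probability_setC// [X in (_ - X)%E]S0 subee.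
rewrite -{1}(setUIDK [set w | S n w = 0%N] [set w | S 0%N w = 0%N]) setIC.
rewrite measureU0 //; [exact: measurableI|exact: measurableD|].
apply: (subset_measure0 _ _ _ PC).
- exact: measurableD.
- exact: measurableC.
- by move=> w [].
Qed.

End RenewalChain.

(** * Comparison of the agreement count with the renewal chain *)

(** [find mism w] counts the letters since the last mismatch. Compared with a step
    of the renewal chain, a step of the word costs at most
    [delta n * zero_prob b m 0], because [zero_prob b m] is largest at [0]. The
    general [m] is the time that remains after the word. *)
Lemma word_mean_zero_prob (R : realType) (F : choiceType) (e : seq F)
    (k : seq F -> F -> R) (mism : pred F) (b delta : nat -> R) :
  stochastic e k ->
  (forall i, 0 <= b i) -> (forall i, b i <= 1) -> (forall i, b i.+1 <= b i) ->
  (forall n, 0 <= delta n) ->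
  (forall w,
    \sum_(a <- e | mism a) k w a <= b (find mism w) + delta (size w)) ->
  forall n m, word_mean e k n (fun w => zero_prob b m (find mism w)) <=
    zero_prob b (n + m) 0 +
    \sum_(0 <= i < n) zero_prob b (m + i) 0 * delta (n.-1 - i)%N.
Proof.
move=> sk b0 b1 bdecr d0 kb; elim=> [|n IH] m.
  by rewrite /= big_geq// addr0.
apply: (@le_trans _ _ (word_mean e k n (fun w =>
    zero_prob b m.+1 (find mism w) + zero_prob b m 0 * delta n))).
  rewrite [leLHS]/=; apply: le_word_mean => // w sw.
  set i := find mism w; set p := \sum_(a <- e | mism a) k w a.
  have p1 : \sum_(a <- e | ~~ mism a) k w a = 1 - p.
    have := sk.2 w; rewrite (bigID mism) /= -/p => <-.
    by rewrite addrAC subrr add0r.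
  have -> : \sum_(a <- e) k w a * zero_prob b m (find mism (a :: w)) =
      p * zero_prob b m 0 + (1 - p) * zero_prob b m i.+1.
    rewrite (bigID mism) /= -p1 /p !mulr_suml; congr (_ + _).
      by apply: eq_bigr => a /= ->.
    by apply: eq_bigr => a /= /negbTE ->.
  have /= := kb w; rewrite -/p -/i sw => pb.
  have /andP[h0 h1] := zero_prob_le0 b0 b1 bdecr m i.+1.
  have := d0 n; rewrite /=; nra.
rewrite word_mean_cstD//; apply: le_trans (lerD (IH m.+1) (lexx _)) _.
rewrite addnS addSn -addrA lerD2l big_nat_recl// addn0 subn0 addrC.
rewrite lerD2l; apply: ler_sum_nat => i /andP[_ ilt].
by rewrite addSnnS -subn1 -subnDA add1n.
Qed.

(** * Laws on sequences *)

(** The value of the law on [C] is the measure of a section of the preimage of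
    [C], and the measure of a section is a measurable function. *)
Lemma exists_law_of_noise (R : realType) (d d' : measure_display)
    (Theta : measurableType d) (T : measurableType d')
    (f : Theta * measurableTypeR R -> T) :
  measurable_fun setT f ->
  exists Q : Theta -> probability T R,
    (forall theta A, Q theta A = noise R [set u | A (f (theta, u))]) /\
    (forall C, measurable C -> measurable_fun setT (fun theta => Q theta C)).
Proof.
move=> mf; have mfs theta : measurable_fun setT (fun u => f (theta, u)).
  exact: measurableT_comp.
pose X theta : {mfun measurableTypeR R >-> T} :=
  HB.pack (fun u => f (theta, u))
    (isMeasurableFun.Build _ _ _ _ (fun u => f (theta, u)) (mfs theta)).
exists (fun theta => distribution (noise R) (X theta)); split=> // C mC.
have mfC : measurable (f @^-1` C).
  by rewrite -[X in measurable X]setTI; exact: mf.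
have := @measurable_fun_xsection _ _ _ _ _ (noise R) _ mfC.
congr (measurable_fun _ _); apply/funext => theta /=.
by rewrite /distribution /pushforward /=; congr (_ _); rewrite xsectionE.
Qed.

Definition letters (E : choiceType) : seq E :=
  finmap.enum_fset (fset_set [set: E]).

Lemma letters_uniq (E : choiceType) : uniq (letters E).
Proof. exact: finmap.fset_uniq. Qed.

Lemma mem_letters (E : choiceType) : finite_set [set: E] ->
  forall a, a \in letters E.
Proof. by move=> finE a; have := in_fset_set finE a; rewrite in_setT. Qed.

Section Sequences.
Context (d : measure_display) (E : measurableType d).

Lemma measurable_coordinate (n : nat) (A : set E) :
  measurable A -> measurable [set y : seqs E | A (y n)].
Proof. by move=> mA; apply: sub_sigma_algebra; exists n, A. Qed.

Lemma measurable_fun_seqs (d' : measure_display) (T : measurableType d')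
    (f : T -> seqs E) :
  (forall n (A : set E), measurable A -> measurable [set t | A (f t n)]) ->
  measurable_fun setT f.
Proof.
move=> mf.
apply: (@measurability _ _ T (seqs E) setT f (@coordinate_sets _ E)) => //.
by move=> _ [_ [n [A [mA ->]]] <-]; rewrite setTI; exact: mf.
Qed.

Definition cylinder n (y : nat -> E) : set (seqs E) :=
  [set u | forall i, (1 <= i <= n)%N -> term u i = term y i].

Lemma cylinderE n y :
  cylinder n y = [set u : seqs E | forall i, (i < n)%N -> u i = y i].
Proof.
apply/seteqP; split=> u /= uy i; first by move=> ilt; exact: (uy i.+1).
by case: i => // i /andP[_ ilt]; exact: uy.
Qed.

Hypothesis finE : finite_set [set: E].
Hypothesis discE : forall A : set E, measurable A.

Lemma measurable_cylinder n y : measurable (cylinder n y).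
Proof.
rewrite cylinderE.
have -> : [set u : seqs E | forall i, (i < n)%N -> u i = y i] =
    \bigcap_(i in [set i | (i < n)%N]) [set u : seqs E | [set y i] (u i)] by [].
apply: bigcap_measurableType => i _.
by apply: measurable_coordinate; exact: discE.
Qed.

(** The empty set makes this family stable under intersection. *)
Definition cylinders : set (set (seqs E)) :=
  [set A | A = set0 \/ exists n y, A = cylinder n y].

Lemma cylindersI : setI_closed cylinders.
Proof.
move=> A B [->|[n [y ->]]]; first by rewrite set0I; left.
move=> [->|[m [z ->]]]; first by rewrite setI0; left.
wlog nm : n m y z / (n <= m)%N.
  by move=> H; case: (leqP n m) => nm; [exact: H|rewrite setIC; exact/H/ltnW].
rewrite !cylinderE.
have [yz|yz] := pselect (forall i, (i < n)%N -> z i = y i).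
  right; exists m, z; rewrite cylinderE; apply/setIidPr => u uz i ilt.
  by rewrite uz ?yz// (leq_trans ilt).
left; apply/seteqP; split=> // u [uy uz]; apply: yz => i ilt.
by rewrite -uy// uz// (leq_trans ilt).
Qed.

Lemma sigma_cylinders : @measurable _ (seqs E) = <<s cylinders >>.
Proof.
apply/seteqP; split.
  apply: smallest_sub; first exact: smallest_sigma_algebra.
  move=> _ [n [A [_ ->]]].
  have -> : [set y : seqs E | A (y n)] = \bigcup_(w in
      [set w | w \in words (letters E) n.+1 /\ A (nth point w n)])
      cylinder n.+1 (nth point w).
    apply/seteqP; split=> u.
      move=> Au; exists (mkseq u n.+1).
        split; last by rewrite nth_mkseq.
        rewrite mem_words ?size_mkseq// => a; exact: mem_letters.
      by rewrite cylinderE => i ilt; rewrite nth_mkseq.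
    move=> [w [_ Aw]]; rewrite cylinderE => /(_ n (ltnSn n)) un.
    by rewrite /= un.
  apply: (@fin_bigcup_measurable _ (g_sigma_algebraType cylinders)).
    apply: (@sub_finite_set _ _ [set` words (letters E) n.+1]).
      by move=> w [].
    exact: finite_seq.
  by move=> w _; apply: sub_sigma_algebra; right; exists n.+1, (nth point w).
apply: smallest_sub; first exact: smallest_sigma_algebra.
by move=> _ [->|[n [y ->]]]; [exact: measurable0|exact: measurable_cylinder].
Qed.

(** Cylinders form a pi-system generating the product sigma-algebra, since a
    condition on one coordinate is a finite union of cylinders. *)
Lemma path_law_unique (R : realType) (k : int -> R.-pker seqs E ~> E) (t0 : int)
    (z : seqs E) (mu nu : probability (seqs E) R) :
  path_law k t0 z mu -> path_law k t0 z nu ->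
  forall A, measurable A -> mu A = nu A.
Proof.
move=> muk nuk A mA.
apply: (measure_unique cylinders (fun=> setT)) => //.
- exact: sigma_cylinders.
- exact: cylindersI.
- move=> _; right; exists 0%N, point; rewrite cylinderE.
  by apply/seteqP; split.
- exact: bigcup_const.
- by move=> _ [->|[n [y ->]]]; rewrite ?measure0// [LHS]muk [RHS]nuk.
- by move=> _; rewrite [X in (X < _)%E]probability_setT ltry.
Qed.

End Sequences.

(** * Distances between kernels *)

Section Coefficients.
Context (R : realType) (d : measure_display) (E : measurableType d).
Hypothesis finE : finite_set [set: E].
Hypothesis discE : forall A : set E, measurable A.

Lemma mass_fun_kmass (k : R.-pker seqs E ~> E) (s : seqs E) :
  mass_fun (letters E) (kmass k s).
Proof.
have fin (A : set E) : k s A \is a fin_num.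
  rewrite ge0_fin_numE//; apply: (@le_lt_trans _ _ (k s setT)).
    by apply: le_measure => //; rewrite inE; exact: discE.
  by rewrite prob_kernel ltry.
split=> [a|]; first by rewrite fine_ge0.
apply: EFin_inj; rewrite -(prob_kernel (s := k) s) -sumEFin.
under eq_bigr do rewrite /kmass fineK//.
rewrite -(@fsbig_finite _ _ _ _ [set: E] (fun a => k s [set a]))//.
rewrite -measure_fin_bigcup//.
- by congr (k s _); apply/seteqP; split=> // a _; exists a.
- by move=> a b _ _ [c [-> ->]].
Qed.

Lemma dTVE (k k' : R.-pker seqs E ~> E) (s s' : seqs E) :
  dTV (k s) (k' s') = tv (letters E) (kmass k s) (kmass k' s').
Proof. by rewrite /dTV /tv fsbig_finite. Qed.

Lemma dTV_bounds (k k' : R.-pker seqs E ~> E) (s s' : seqs E) :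
  0 <= dTV (k s) (k' s') <= 1.
Proof.
by rewrite dTVE tv_ge0 tv_le1//; exact: mass_fun_kmass.
Qed.

Lemma dTV_le_sup_dTV (k k' : R.-pker seqs E ~> E) (s : seqs E) :
  dTV (k s) (k' s) <= sup_dTV k k'.
Proof.
apply: ub_le_sup; last by exists s.
by exists 1 => _ [s' _ <-]; have /andP[] := dTV_bounds k k' s' s'.
Qed.

Lemma sup_dTV_ge0 (k k' : R.-pker seqs E ~> E) : 0 <= sup_dTV k k'.
Proof.
apply: le_trans (dTV_le_sup_dTV k k' point).
by have /andP[] := dTV_bounds k k' point point.
Qed.

Section MemoryCoef.
Context (X : pointedType) (q : int -> X -> R.-pker seqs E ~> E).

Let influences m := [set r | exists t x y y', eq_upto m y y' /\
  r = dTV (q t x y) (q t x y')].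

Let influences_ubound m : has_ubound (influences m).
Proof.
exists 1 => _ [t [x [y [y' [_ ->]]]]].
by have /andP[] := dTV_bounds (q t x) (q t x) y y'.
Qed.

Let influences_neq0 m : influences m !=set0.
Proof.
exists (dTV (q 0 point point) (q 0 point point)).
by exists 0, point, point, point; split.
Qed.

Lemma dTV_le_memory_coef m t x (y y' : seqs E) : eq_upto m y y' ->
  dTV (q t x y) (q t x y') <= memory_coef q m.
Proof.
by move=> yy'; apply: (ub_le_sup (influences_ubound m)); exists t, x, y, y'.
Qed.

Lemma memory_coef_ge0 m : 0 <= memory_coef q m.
Proof.
have [r mr] := influences_neq0 m.
apply: le_trans (ub_le_sup (influences_ubound m) mr).
case: mr => t [x [y [y' [_ ->]]]].
by have /andP[] := dTV_bounds (q t x) (q t x) y y'.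
Qed.

Lemma memory_coef_le1 m : memory_coef q m <= 1.
Proof.
apply: (ge_sup (influences_neq0 _)) => _ [t [x [y [y' [_ ->]]]]].
by have /andP[] := dTV_bounds (q t x) (q t x) y y'.
Qed.

Lemma memory_coef_decr m : memory_coef q m.+1 <= memory_coef q m.
Proof.
apply: (ge_sup (influences_neq0 _)) => _ [t [x [y [y' [yy' ->]]]]].
by apply: dTV_le_memory_coef => i im; apply: yy'; exact: ltnW.
Qed.

End MemoryCoef.
End Coefficients.

(** * One step of the coupled chain *)

Section Steps.
Context (R : realType) (d : measure_display) (E : measurableType d).
Hypothesis finE : finite_set [set: E].
Hypothesis discE : forall A : set E, measurable A.
Implicit Types (w : seq E) (y z : seqs E) (k : int -> R.-pker seqs E ~> E).

(** The past seen after the word [w] has been added in front of the initial past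
    [z]; it is [past] read on words instead of sequences. *)
Definition history w z : seqs E :=
  fun j => if (j < size w)%N then nth (z 0%N) w j else z (j - size w)%N.

Lemma past_history y z n : past y z n = history (rev (mkseq y n)) z.
Proof.
apply/funext => j; rewrite /past /history size_rev size_mkseq.
case: ifP => // jn; rewrite nth_rev size_mkseq// nth_mkseq.
  by rewrite /term subnS.
by rewrite ltn_subrL (leq_ltn_trans _ jn).
Qed.

Lemma measurable_history w : measurable_fun setT (history w : seqs E -> seqs E).
Proof.
apply: measurable_fun_seqs => n A mA; case: (ltnP n (size w)) => nw.
  have -> : [set z | A (history w z n)] = [set z : seqs E | A (nth point w n)].
    by apply/seteqP; split=> z /=;
      rewrite /history nw (set_nth_default point (z 0%N) nw).
  have [An|An] := pselect (A (nth point w n)).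
    by rewrite (_ : [set _ | _] = setT)//; apply/seteqP; split.
  by rewrite (_ : [set _ | _] = set0)//; apply/seteqP; split.
have -> : [set z | A (history w z n)] = [set z : seqs E | A (z (n - size w)%N)].
  by apply/seteqP; split=> z /=; rewrite /history ltnNge nw.
exact: measurable_coordinate.
Qed.

Definition kernel_step k (t0 : int) z w : E -> R :=
  kmass (k (t0 + (size w).+1%:Z)) (history w z).

Lemma word_mass_path k t0 z y n :
  word_mass (kernel_step k t0 z) (rev (mkseq y n)) =
  \prod_(1 <= i < n.+1) kmass (k (t0 + i%:Z)) (past y z i.-1) (term y i).
Proof.
elim: n => [|n IH]; first by rewrite big_geq.
rewrite mkseqS rev_rcons /= IH [RHS]big_nat_recr//=.
by rewrite past_history /kernel_step size_rev size_mkseq.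
Qed.

Definition pairs : seq (E * E) := [seq (a, b) | a <- letters E, b <- letters E].

Lemma pairs_uniq : uniq pairs.
Proof.
apply: allpairs_uniq; rewrite ?letters_uniq//.
by move=> [a b] [a1 b1] _ _ /= [-> ->].
Qed.

Lemma mem_pairs ab : ab \in pairs.
Proof.
by case: ab => a b; apply/allpairsP; exists (a, b); rewrite !mem_letters.
Qed.

Definition coupled_step k k' t0 z z' (w : seq (E * E)) : E * E -> R :=
  coupling (letters E) (kernel_step k t0 z (map fst w))
    (kernel_step k' t0 z' (map snd w)).

Lemma stochastic_coupled_step k k' t0 z z' :
  stochastic pairs (coupled_step k k' t0 z z').
Proof.
split=> [w ab|w].
  by apply: coupling_ge0; exact: mass_fun_kmass.
rewrite big_allpairs_dep /=.
have [_ <-] := mass_fun_kmass finE discE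
  (k (t0 + (size (map fst w)).+1%:Z)) (history (map fst w) z).
apply: eq_bigr => a _; apply: coupling_fst; rewrite ?letters_uniq//.
- exact: mem_letters.
- exact: mass_fun_kmass.
- exact: mass_fun_kmass.
Qed.

Lemma coupled_step_fst k k' t0 z z' (w : seq (E * E)) a :
  \sum_(ab <- pairs | ab.1 == a) coupled_step k k' t0 z z' w ab =
  kernel_step k t0 z (map fst w) a.
Proof.
rewrite big_mkcond big_allpairs_dep /=.
rewrite (bigD1_seq a) ?letters_uniq ?mem_letters//= eqxx.
rewrite [X in _ + X]big1 ?addr0 => [|a' /negbTE a'a]; last first.
  by rewrite a'a big1.
apply: coupling_fst; rewrite ?letters_uniq//.
- exact: mem_letters.
- exact: mass_fun_kmass.
- exact: mass_fun_kmass.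
Qed.

Lemma coupled_step_snd k k' t0 z z' (w : seq (E * E)) b :
  \sum_(ab <- pairs | ab.2 == b) coupled_step k k' t0 z z' w ab =
  kernel_step k' t0 z' (map snd w) b.
Proof.
rewrite big_mkcond big_allpairs_dep exchange_big /=.
rewrite (bigD1_seq b) ?letters_uniq ?mem_letters//= eqxx.
rewrite [X in _ + X]big1 ?addr0 => [|b' /negbTE b'b]; last first.
  by rewrite b'b big1.
apply: coupling_snd; rewrite ?letters_uniq//.
- exact: mem_letters.
- exact: mass_fun_kmass.
- exact: mass_fun_kmass.
Qed.

Definition differ : pred (E * E) := fun ab => ab.1 != ab.2.

(** Recent agreements of the letters are agreements of the pasts, whatever the
    initial pasts [z] and [z'] are. *)
Lemma eq_upto_history z z' (w : seq (E * E)) :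
  eq_upto (find differ w) (history (map fst w) z) (history (map snd w) z').
Proof.
move=> i ilt; have iw := leq_trans ilt (find_size _ _).
rewrite /history !size_map iw !(nth_map point)//.
by have := before_find point ilt; rewrite /differ => /negbFE/eqP.
Qed.

(** The kernel [q] seen from the second past is an intermediate law: it is reached
    from [q] at the first past at the cost of a memory coefficient, and left for
    [q'] at the cost of the distance of the two kernels. *)
Lemma coupled_step_differ (X : pointedType)
    (q q' : int -> X -> R.-pker seqs E ~> E) x t0 z z' (w : seq (E * E)) :
  \sum_(ab <- pairs | differ ab)
    coupled_step (q ^~ x) (q' ^~ x) t0 z z' w ab <=
  memory_coef q (find differ w) +
    sup_dTV (q (t0 + (size w).+1%:Z) x) (q' (t0 + (size w).+1%:Z) x).
Proof.
rewrite big_mkcond big_allpairs_dep /=.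
under eq_bigr do rewrite -big_mkcond.
apply: le_trans (coupling_neq _ _) _; rewrite ?letters_uniq//.
- exact: mass_fun_kmass.
- exact: mass_fun_kmass.
rewrite /kernel_step !size_map; set t := t0 + _.
apply: le_trans (tv_triangle _ _
  (kmass (q t x) (history (map snd w) z')) _) _.
rewrite -!dTVE//; apply: lerD; last exact: dTV_le_sup_dTV.
by apply: dTV_le_memory_coef => //; exact: eq_upto_history.
Qed.

End Steps.

(** * The coupled paths *)

Lemma measurable_coupling (R : realType) (d : measure_display)
    (Theta : measurableType d) (T : choiceType) (e : seq T)
    (p q : Theta -> T -> R) (ab : T * T) :
  (forall a, measurable_fun setT (p ^~ a)) ->
  (forall a, measurable_fun setT (q ^~ a)) ->
  measurable_fun setT (fun theta => coupling e (p theta) (q theta) ab).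
Proof.
move=> mp mq.
have mexcess (f g : Theta -> T -> R) a : measurable_fun setT (f ^~ a) ->
    measurable_fun setT (g ^~ a) ->
    measurable_fun setT (fun theta => excess (f theta) (g theta) a).
  by move=> mf mg; apply: measurable_funB => //; exact: measurable_minr.
rewrite /coupling; apply: measurable_funD.
  by apply: measurable_funM => //; exact: measurable_minr.
apply: measurable_funM.
  by apply: measurable_funM; exact: mexcess.
(* On nonnegative reals the inverse, with [0] sent to [0], is the power [-1]. *)
rewrite (_ : (fun _ => _) = (fun x => powR x (-1)) \o
    (fun theta => \sum_(a <- e) excess (p theta) (q theta) a)); last first.
  apply/funext => theta /=; rewrite powR_inv1// sumr_ge0// => a _.
  exact: excess_ge0.
apply: measurableT_comp; first exact: measurable_powR.
by apply: measurable_sum => a; exact: mexcess.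
Qed.

Section CoupledChain.
Context (R : realType) (d : measure_display) (E : measurableType d).
Hypothesis finE : finite_set [set: E].
Hypothesis discE : forall A : set E, measurable A.
Context (dT : measure_display) (Theta : measurableType dT).
Context (k k' : Theta -> int -> R.-pker seqs E ~> E) (t0 : int).
Context (past1 past2 : Theta -> seqs E).

Let step theta w := coupled_step (k theta) (k' theta) t0 (past1 theta)
  (past2 theta) w.

Let start : E * E := point.

Hypothesis mstep :
  forall w ab, measurable_fun setT (fun theta => step theta w ab).

Let sstep theta : stochastic (pairs E) (step theta).
Proof. exact: stochastic_coupled_step. Qed.

Definition letter_pair (p : Theta * measurableTypeR R) (n : nat) : E * E :=
  head start (code (pairs E) start (step p.1) p.2 n.+1).

Lemma codeE p n :
  code (pairs E) start (step p.1) p.2 n = rev (mkseq (letter_pair p) n).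
Proof.
by elim: n => // n IH;  rewrite mkseqS rev_rcons -IH.
Qed.

Definition first_path p : seqs E := fun n => (letter_pair p n).1.
Definition second_path p : seqs E := fun n => (letter_pair p n).2.

Lemma measurable_letter_pair n (A : set (E * E)) :
  measurable [set p | A (letter_pair p n)].
Proof.
exact: (measurable_code start (pairs_uniq E) (mem_pairs finE) sstep mstep n.+1
  [set w | A (head start w)]).
Qed.

Lemma measurable_first_path : measurable_fun setT first_path.
Proof.
apply: measurable_fun_seqs => n A _.
exact: (measurable_letter_pair n [set ab | A ab.1]).
Qed.

Lemma measurable_second_path : measurable_fun setT second_path.
Proof.
apply: measurable_fun_seqs => n A _.
exact: (measurable_letter_pair n [set ab | A ab.2]).
Qed.

Lemma noise_prefix theta n (G : set (seq (E * E))) :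
  noise R [set u | G (rev (mkseq (letter_pair (theta, u)) n))] =
  (word_mean (pairs E) (step theta) n (fun w => (`[< G w >])%:R))%:E.
Proof.
rewrite -(noise_code start (pairs_uniq E) (mem_pairs finE) sstep mstep).
by congr (noise R _); apply/seteqP; split=> u /=; rewrite -codeE.
Qed.

(** A cylinder for the marginal path fixes the image under [f] of the coded word,
    and these images form a chain by [word_mean_image]. *)
Lemma noise_cylinder (f : E * E -> E) (j : int -> R.-pker seqs E ~> E) theta z :
  (forall w a, \sum_(ab <- pairs E | f ab == a) step theta w ab =
    kernel_step j t0 z (map f w) a) ->
  forall (n : nat) (y : nat -> E),
  noise R [set u | cylinder n y (fun i => f (letter_pair (theta, u) i))] =
  (\prod_(1 <= i < n.+1) kmass (j (t0 + i%:Z)) (past y z i.-1) (term y i))%:E.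
Proof.
move=> fstep n y; rewrite -word_mass_path -(word_mean_image _ fstep).
rewrite size_rev size_mkseq.
have := noise_prefix theta n [set w | map f w = rev (mkseq y n)].
rewrite (_ : (fun w => (`[<_>])%:R) =
  (fun w => (map f w == rev (mkseq y n))%:R)).
  move=> <-; congr (noise R _); rewrite cylinderE; apply/seteqP; split=> u /=.
    move=> uy; rewrite map_rev; congr rev; rewrite /mkseq -map_comp.
    by apply/eq_in_map => i; rewrite mem_iota => /andP[_ /uy].
  rewrite map_rev => /(congr1 rev); rewrite !revK => uy i ilt.
  have := congr1 (fun s => nth point s i) uy.
  by rewrite -map_comp -/(mkseq _ n) !nth_mkseq.
by apply/funext => w; congr (nat_of_bool _)%:R => /=; apply/asboolP/eqP.
Qed.

End CoupledChain.


Lemma measurable_kernel_step (R : realType) (d : measure_display)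
    (E : measurableType d) (X : ptopologicalType)
    (q : int -> X -> R.-pker seqs E ~> E) (t0 : int)
    (dT : measure_display) (Theta : measurableType dT)
    (x : Theta -> borel X) (z : Theta -> seqs E) (w : seq E) (a : E) :
  (forall t : int, measurable_fun [set: E * seqs E * borel X]
     (fun p : E * seqs E * borel X => kmass (q t p.2) p.1.2 p.1.1)) ->
  measurable_fun setT x -> measurable_fun setT z ->
  measurable_fun setT
    (fun theta => kernel_step (q ^~ (x theta)) t0 (z theta) w a).
Proof.
move=> mq mx mz; set t := t0 + (size w).+1%:Z.
apply: (measurableT_comp (mq t)
  (g := fun theta => (a, history w (z theta) : seqs E, x theta))).
apply: measurable_fun_pair => //; apply: measurable_fun_pair => //.
exact: (measurableT_comp (measurable_history w)).
Qed.

Theorem lemma1 (R : realType)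
  (d : measure_display) (E : measurableType d)
  (finE : finite_set [set: E]) (discE : forall A : set E, measurable A)
  (X : ptopologicalType) (polX : polish R X)
  (q qbar : int -> X -> R.-pker seqs E ~> E)
  (A1_measurable : forall t : int,
     measurable_fun [set: E * seqs E * borel X]
       (fun p : E * seqs E * borel X => kmass (q t p.2) p.1.2 p.1.1) /\
     measurable_fun [set: E * seqs E * borel X]
       (fun p : E * seqs E * borel X => kmass (qbar t p.2) p.1.2 p.1.1))
  (A1_positive : forall (t : int) (x : X) (z : seqs E) (y : E),
     0 < kmass (q t x) z y /\ 0 < kmass (qbar t x) z y)
  (A2_b0 : memory_coef q 0 < 1)
  (A2_lim : memory_coef q m @[m --> \oo] --> (0 : R))
  (dO : measure_display) (Omega : measurableType dO) (P : probability Omega R)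
  (S : nat -> {RV P >-> nat})
  (chainS : markov_chain S 0 (renewal_matrix (memory_coef q)))
  (t0 : int) :
  exists Q Qbar : X -> seqs E -> probability (seqs E) R,
    (forall x z, path_law (fun t => q t x) t0 z (Q x z)) /\
    (forall x z, path_law (fun t => qbar t x) t0 z (Qbar x z)) /\
    exists Qt : X -> seqs E -> seqs E -> probability (seqs E * seqs E)%type R,
      [/\ forall (x : X) (z zbar : seqs E) (A B : set (seqs E)),
            measurable A -> measurable B ->
            Qt x z zbar (A `*` setT) = Q x z A /\
            Qt x z zbar (setT `*` B) = Qbar x zbar B,
          forall (x : X) (z zbar : seqs E) (t : nat), (1 <= t)%N ->
            (Qt x z zbar [set y | term y.1 t <> term y.2 t] <=
             (bstar S (memory_coef q) t.-1
              + sup_dTV (q (t%:Z + t0) x) (qbar (t%:Z + t0) x)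
              + \sum_(0 <= l < t.-1) bstar S (memory_coef q) l
                  * sup_dTV (q (t%:Z + t0 - l%:Z - 1) x)
                            (qbar (t%:Z + t0 - l%:Z - 1) x))%:E)%E
        & forall C : set (seqs E * seqs E), measurable C ->
            measurable_fun [set: borel X * seqs E * seqs E]
              (fun p : borel X * seqs E * seqs E => Qt p.1.1 p.1.2 p.2 C)].
Proof.
set b := memory_coef q.
have b0 i : 0 <= b i by exact: memory_coef_ge0.
have b1 i : b i <= 1 by exact: memory_coef_le1.
have bdecr i : b i.+1 <= b i by exact: memory_coef_decr.
pose Theta := (borel X * seqs E * seqs E)%type.
pose k (theta : Theta) t := q t theta.1.1.
pose kbar (theta : Theta) t := qbar t theta.1.1.
pose z1 (theta : Theta) := theta.1.2.
pose z2 (theta : Theta) := theta.2.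
pose step theta := coupled_step (k theta) (kbar theta) t0 (z1 theta) (z2 theta).
have mstep w ab : measurable_fun setT (fun theta => step theta w ab).
  have mx : measurable_fun setT (fun theta : Theta => theta.1.1).
    exact: (measurableT_comp measurable_fst measurable_fst).
  have mz : measurable_fun setT (fun theta : Theta => theta.1.2).
    exact: (measurableT_comp measurable_snd measurable_fst).
  apply: measurable_coupling => a.
    exact: (measurable_kernel_step _ _ _ (fun t => (A1_measurable t).1) mx mz).
  exact: (measurable_kernel_step _ _ _ (fun t => (A1_measurable t).2) mx
    measurable_snd).
pose Y1 := first_path k kbar t0 z1 z2.
pose Y2 := second_path k kbar t0 z1 z2.
have mY1 : measurable_fun setT Y1 by exact: measurable_first_path.
have mY2 : measurable_fun setT Y2 by exact: measurable_second_path.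
have [Q1 [Q1E _]] := exists_law_of_noise mY1.
have [Q2 [Q2E _]] := exists_law_of_noise mY2.
have [Qt [QtE mQt]] := exists_law_of_noise (measurable_fun_pair mY1 mY2).
have Q1path x z zbar : path_law (q ^~ x) t0 z (Q1 (x, z, zbar)).
  move=> n y; rewrite Q1E.
  have fstep w a : \sum_(ab <- pairs E | ab.1 == a) step (x, z, zbar) w ab =
      kernel_step (q ^~ x) t0 z (map fst w) a by exact: coupled_step_fst.
  exact: (noise_cylinder finE discE mstep fstep n y).
have Q2path x z zbar : path_law (qbar ^~ x) t0 zbar (Q2 (x, z, zbar)).
  move=> n y; rewrite Q2E.
  have fstep w a : \sum_(ab <- pairs E | ab.2 == a) step (x, z, zbar) w ab =
      kernel_step (qbar ^~ x) t0 zbar (map snd w) a by exact: coupled_step_snd.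
  exact: (noise_cylinder finE discE mstep fstep n y).
(* By uniqueness of path laws, a marginal of the coupling depends on its own
   initial past only; the same past is repeated in the place of the other. *)
exists (fun x z => Q1 (x, z, z)), (fun x z => Q2 (x, z, z)).
split; first by move=> x z; exact: Q1path.
split; first by move=> x z; exact: Q2path.
exists (fun x z zbar => Qt (x, z, zbar)); split.
- move=> x z zbar A B mA mB; split.
    rewrite -(path_law_unique finE discE (Q1path x z zbar) (Q1path x z z) mA).
    rewrite QtE Q1E; congr (noise R _).
    by apply/seteqP; split=> u /=; [case|].
  rewrite -(path_law_unique finE discE (Q2path x z zbar) (Q2path x zbar zbar)
    mB).
  rewrite QtE Q2E; congr (noise R _).
  by apply/seteqP; split=> u /=; [case|].
- move=> x z zbar [//|n] _; rewrite QtE.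
  pose delta j := sup_dTV (q (t0 + j.+1%:Z) x) (qbar (t0 + j.+1%:Z) x).
  set theta := (x, z, zbar).
  have sstep : stochastic (pairs E) (step theta).
    exact: stochastic_coupled_step.
  (* At [l = 0] this is an equality, by the convention [b*_0 = b_0]; at [l > 0]
     one step is lost. *)
  have bstar_ge l : zero_prob b l.+1 0 <= bstar S b l.
    case: l => [|l]; first by rewrite /bstar /= mulr1 mulr0 addr0.
    rewrite /bstar [_ == _]/= (markov_chain_zero_prob b0 b1 chainS).
    exact: zero_prob_start_decr.
  have mean_le := @word_mean_zero_prob _ _ (pairs E) (step theta)
    (@differ _ E) b delta sstep b0 b1 bdecr (fun=> sup_dTV_ge0 finE discE _ _)
    (fun w => coupled_step_differ finE discE _ _ _ _ _ _ _) n.+1 0%N.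
  have -> : noise R [set u |
      term (Y1 (theta, u)) n.+1 <> term (Y2 (theta, u)) n.+1] =
      (word_mean (pairs E) (step theta) n.+1
        (fun w => (`[< differ (head point w) >])%:R))%:E.
    rewrite -(noise_prefix finE discE mstep theta n.+1
      [set w | differ (head point w)]).
    by congr (noise R _); apply/seteqP; split=> u /=;
      rewrite mkseqS rev_rcons /differ /=; move/eqP.
  rewrite (_ : word_mean _ _ _ _ = word_mean (pairs E) (step theta) n.+1
      (fun w => zero_prob b 0 (find (@differ _ E) w))); last first.
    apply: eq_word_mean => -[//|ab w] _ /=; rewrite asboolb.
    by case: (differ ab).
  rewrite lee_fin; apply: le_trans mean_le _.
  (* The term of index [0] is the discrepancy at the last time itself. *)
  rewrite addn0 big_nat_recl// -[leRHS]addrA.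
  apply: lerD; first exact: bstar_ge.
  apply: lerD.
    by rewrite /= mul1r subn0 /delta addrC.
  apply: ler_sum_nat => l /andP[_ ln].
  have -> : n.+1%:Z + t0 - l%:Z - 1 = t0 + (n - l.+1).+1%:Z.
    by rewrite subnSK// -subzn ?(ltnW ln)//; lia.
  by rewrite add0n; apply: ler_wpM2r; [exact: sup_dTV_ge0|exact: bstar_ge].
- move=> C mC; rewrite (_ : (fun p => _) = (fun theta => Qt theta C)).
    exact: mQt.
  by apply/funext => -[[x z] zbar].
Qed.
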